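(* Let $n,m,T\in\mathbb{N}$, $U\subset\mathbb{R}^m$, $X_t\subset\mathbb{R}^n$ for $t\in\{0,\dots,T\}$, $f:\mathbb{R}^n\times\mathbb{R}^m\times\mathbb{N}\to\mathbb{R}^n$, $x_0\in X_0$, and let $J:U^T\times\prod_{t=0}^T X_t\to\mathbb{R}$ be a naturally monotonically backward separable function with representation maps $\{\phi_t\}_{t=0}^T$. Suppose $\Gamma_{x,t}\neq\emptyset$ for all $t\in\{0,\dots,T-1\}$ and $x\in X_t$. Suppose furthermore that the representation maps are strictly monotonic in their third argument: for every $t\in\{0,\dots,T-1\}$, if $z,w\in \mathrm{Image}\{\phi_{t+1}\}$ and $z>w$, then $\phi_t(x,u,z)>\phi_t(x,u,w)$ for all $(x,u)\in X_t\times U$. Let $V:\mathbb{R}^n\times[0,T]\to\mathbb{R}$ satisfy the Generalized Bellman's Equation $$V(x,T)=\phi_T(x)\ \text{ for all } x\in X_T,$$ $$V(x,t)=\inf_{u\in\Gamma_{x,t}}\phi_t\big(x,u,V(f(x,u,t),t+1)\big)\ \text{ for all } t\in\{0,\dots,T-1\},\ x\in X_t .$$ Then $\mathbf{u}^*=(u^*(0),\dots,u^*(T-1))$ and $\mathbf{x}^*=(x^*(0),\dots,x^*(T))$ solve the MSOP associated with $\{J,f,\{X_t\}_{0\le t\le T},U,T\}$ with initial condition $x_0$ if and only if $$x^*(0)=x_0,\qquad x^*(k+1)=f(x^*(k),u^*(k),k)\quad\text{for } k\in\{0,\dots,T-1\},$$ and $$u^*(k)\in\arg\inf_{u\in\Gamma_{x^*(k),k}}\phi_k\big(x^*(k),u,V(f(x^*(k),u,k),k+1)\big)\quad\text{for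 } k\in\{0,\dots,T-1\}.$$
   Context: **MSOP.** The Multi-Stage Optimization Problem (MSOP) associated with the tuple $\{J,f,\{X_t\}_{0\le t\le T},U,T\}$ and initial condition $x_0$ is: minimize $J(\mathbf{u},\mathbf{x})$ over $\mathbf{u}=(u(0),\dots,u(T-1))$, $\mathbf{x}=(x(0),\dots,x(T))$ subject to $x(0)=x_0$, $x(t+1)=f(x(t),u(t),t)$ and $u(t)\in U$ for $t=0,\dots,T-1$, and $x(t)\in X_t$ for $t=0,\dots,T$. A pair $(\mathbf{u}^*,\mathbf{x}^* )$ solves the MSOP if it is feasible and attains the minimum. **Feasible inputs.** For $t\in\{0,\dots,T-1\}$ and $x\in X_t$, $\Gamma_{x,t}:=\{u\in U: f(x,u,t)\in X_{t+1}\}$. Membership in $\arg\inf_{u\in\Gamma}$ of a function means belonging to $\Gamma$ and attaining the infimum over $\Gamma$. **Monotonically backward separable.** $\mathrm{Image}\{g\}$ denotes the image set of a function $g$. $J:U^T\times\prod_{t=0}^T X_t\to\mathbb{R}$ is monotonically backward separable if there exist representation maps $\phi_T:X_T\to\mathbb{R}$ and $\phi_t:X_t\times U\times\mathrm{Image}\{\phi_{t+1}\}\to\mathbb{R}$ for $t=0,\dots,T-1$ such that (1) $J(\mathbf{u},\mathbf{x})=\phi_0(x(0),u(0),\phi_1(x(1),u(1),\dots\phi_T(x(T))\dots))$, where $\mathbf{u}=(u(0),\dots,u(T-1))$ and $\mathbf{x}=(x(0),\dots,x(T))$; and (2) each $\phi_t$ is monotonic in its third argument: if $z,w\in\mathrm{Image}\{\phi_{t+1}\}$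 and $z\ge w$ then $\phi_t(x,u,z)\ge\phi_t(x,u,w)$ for all $(x,u)\in X_t\times U$. **Naturally monotonically backward separable.** $J$ is naturally monotonically backward separable (with representation maps $\{\phi_t\}$) if (1), (2) hold and in addition: (3) (upper semi-continuity in the third argument) for any $t\in\{0,\dots,T-1\}$, $x\in X_t$, $u\in U$ and any monotonically decreasing sequence $\{z_n\}_{n\in\mathbb{N}}\subset\mathrm{Image}\{\phi_{t+1}\}$ (i.e. $z_{n+1}\le z_n$ for all $n$), $\lim_{n\to\infty}\phi_t(x,u,z_n)=\phi_t(x,u,\lim_{n\to\infty}z_n)$; and (4) (boundedness) for each $t\in\{0,\dots,T\}$ there exists $R>0$ such that $\mathrm{Image}\{\phi_t\}\subset\{y\in\mathbb{R}:|y|<R\}$. *)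

(* Defs.v *)
From mathcomp Require Import all_boot all_order all_algebra.
From mathcomp Require Import all_classical all_reals all_analysis.

Set Implicit Arguments.
Unset Strict Implicit.
Unset Printing Implicit Defensive.

Import Order.TTheory GRing.Theory Num.Theory.
Import numFieldNormedType.Exports.

Local Open Scope classical_set_scope.
Local Open Scope ring_scope.

(* Points of R^n are row vectors.  Families indexed by time ([X], [phi], [V])
   are functions of a natural number of which only the indices up to [T] are
   ever used.  Input sequences u(0), ..., u(T-1) and state sequences
   x(0), ..., x(T) are functions on ['I_T] and ['I_T.+1]; the state x(t), for
   t : nat with t <= T, is written [x (inord t)].

   The objective J and the representation maps phi_t (t < T), phi_T, written
   [phi t] and [phiT], are total functions; conditions on them are imposed only
   on U^T * prod_t X_t, X_t * U * Image{phi_(t+1)} and X_T respectively, except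
   that phi_t is also evaluated at limits of decreasing sequences of
   Image{phi_(t+1)}. *)

Section MSOP.
Variables (R : realType) (n m T : nat).
Variables (f : 'rV[R]_n -> 'rV[R]_m -> nat -> 'rV[R]_n).
Variables (X : nat -> set 'rV[R]_n) (U : set 'rV[R]_m).

Definition feasible (x0 : 'rV[R]_n)
    (u : 'I_T -> 'rV[R]_m) (x : 'I_T.+1 -> 'rV[R]_n) : Prop :=
  [/\ x ord0 = x0,
      forall t : 'I_T, x (inord t.+1) = f (x (inord t)) (u t) t,
      forall t : 'I_T, U (u t)
    & forall t : 'I_T.+1, X t (x t)].

Definition solves_MSOP
    (J : ('I_T -> 'rV[R]_m) -> ('I_T.+1 -> 'rV[R]_n) -> R) (x0 : 'rV[R]_n)
    (us : 'I_T -> 'rV[R]_m) (xs : 'I_T.+1 -> 'rV[R]_n) : Prop :=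
  feasible x0 us xs /\ forall u x, feasible x0 u x -> J us xs <= J u x.

Definition Gamma (x : 'rV[R]_n) (t : nat) : set 'rV[R]_m :=
  [set u | U u /\ X t.+1 (f x u t)].

(* The infimum is taken in the extended reals, so that no default value can
   interfere when the values of [F] on [G] are not bounded below. *)
Definition arginf (G : set 'rV[R]_m) (F : 'rV[R]_m -> R) : set 'rV[R]_m :=
  [set u | G u /\ (F u)%:E = ereal_inf [set (F v)%:E | v in G]].

Variables (phi : nat -> 'rV[R]_n -> 'rV[R]_m -> R -> R) (phiT : 'rV[R]_n -> R).

(* [phi_image t] is Image{phi_t}, for t <= T; since the domain of phi_t is
   X_t * U * Image{phi_(t+1)}, it is defined by descending recursion on t. *)
Inductive phi_image : nat -> R -> Prop :=
| phi_image_last x : X T x -> phi_image T (phiT x)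
| phi_image_step t x u z :
    (t < T)%N -> X t x -> U u -> phi_image t.+1 z -> phi_image t (phi t x u z).

(* phi_0(x(0), u(0), phi_1(x(1), u(1), ... phi_T(x(T)) ... )) *)
Definition nested_phi (u : 'I_T -> 'rV[R]_m) (x : 'I_T.+1 -> 'rV[R]_n) : R :=
  foldr (fun (t : 'I_T) z => phi t (x (inord t)) (u t) z)
        (phiT (x ord_max)) (enum 'I_T).

Definition monotonically_backward_separable
    (J : ('I_T -> 'rV[R]_m) -> ('I_T.+1 -> 'rV[R]_n) -> R) : Prop :=
  (forall u x, (forall t : 'I_T, U (u t)) -> (forall t : 'I_T.+1, X t (x t)) ->
     J u x = nested_phi u x) /\
  (forall t z w, (t < T)%N -> phi_image t.+1 z -> phi_image t.+1 w -> w <= z ->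
     forall x u, X t x -> U u -> phi t x u w <= phi t x u z).

(* In the second clause the limit [l] need not belong to Image{phi_(t+1)}: the
   clause then fixes the value of phi_t(x, u, .) at [l].  By the third clause
   every such sequence has a limit in R. *)
Definition naturally_monotonically_backward_separable
    (J : ('I_T -> 'rV[R]_m) -> ('I_T.+1 -> 'rV[R]_n) -> R) : Prop :=
  [/\ monotonically_backward_separable J,
      forall t x u (z : nat -> R) (l : R), (t < T)%N -> X t x -> U u ->
        (forall k, phi_image t.+1 (z k)) -> (forall k, z k.+1 <= z k) ->
        z @ \oo --> l -> (fun k => phi t x u (z k)) @ \oo --> phi t x u l
    & forall t, (t <= T)%N ->
        exists2 B : R, 0 < B & forall y, phi_image t y -> `|y| < B].

Definition strictly_monotonic : Prop :=
  forall t z w, (t < T)%N -> phi_image t.+1 z -> phi_image t.+1 w -> w < z ->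
    forall x u, X t x -> U u -> phi t x u w < phi t x u z.

Definition generalized_Bellman (V : 'rV[R]_n -> nat -> R) : Prop :=
  (forall x, X T x -> V x T = phiT x) /\
  (forall t x, (t < T)%N -> X t x ->
     (V x t)%:E =
     ereal_inf [set (phi t x u (V (f x u t) t.+1))%:E | u in Gamma x t]).

End MSOP.

(* Main.v *)
Require Import Defs.
From mathcomp Require Import all_boot all_order all_algebra.
From mathcomp Require Import all_classical all_reals all_analysis.
Local Open Scope classical_set_scope.
Local Open Scope ring_scope.

(** V(x,t) is the infimum of the costs-to-go of the feasible continuations from
    x at time t.  It need not belong to Image{phi_t}, where monotonicity is
    available, but it is the limit of a decreasing sequence of costs-to-go, so
    upper semi-continuity carries monotonicity over to it.  A trajectory of
    arginf inputs has cost V(x_0,0), hence is optimal.  Conversely, if the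
    cost-to-go of an optimal trajectory at some time k exceeded V(x(k),k), a
    cheaper continuation would, by strict monotonicity of phi_0, ..., phi_(k-1),
    give a smaller total cost; so costs-to-go equal V along the trajectory,
    which is the arginf condition. *)

Import Order.TTheory GRing.Theory Num.Theory.
Import numFieldNormedType.Exports.

Lemma descending_ind (P : nat -> Prop) (T : nat) :
  P T -> (forall k, (k < T)%N -> P k.+1 -> P k) -> forall k, (k <= T)%N -> P k.
Proof.
move=> PT PS k kT; rewrite -(subKn kT).
elim: (T - k)%N (leq_subr k T) => [|d IH] dT; first by rewrite subn0.
apply: PS; first by rewrite ltn_subrL (leq_ltn_trans _ dT).
by rewrite subnSK //; apply: IH; exact: ltnW.
Qed.

(** Running minima of elements of [S] chosen below l + 1/(k+1). Starting at the prescribed [c0]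
    keeps every term at most [c0]. *)
Lemma decreasing_cvg_inf (R : realType) (S : set R) (l c0 : R) :
  S c0 -> (forall c, S c -> l <= c) ->
  (forall y, l < y -> exists2 c, S c & c < y) ->
  exists z : nat -> R,
    [/\ z 0%N = c0, forall k, S (z k), forall k, z k.+1 <= z k
      & z @ \oo --> l].
Proof.
move=> Sc0 lbS approx.
have /choice[c Hc] : forall k, exists c, S c /\ c < l + k.+1%:R^-1.
  move=> k; have [|c Sc cl] := approx (l + k.+1%:R^-1).
    by rewrite ltrDl invr_gt0 ltr0n.
  by exists c.
pose z := fix z k := if k is k'.+1 then Num.min (z k') (c k') else c0.
have Sz k : S (z k).
  by elim: k => //= k IH; case: leP => // _; exact: (Hc k).1.
exists z; split => // [k|]; first by rewrite /= ge_min lexx.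
(* The shift matches indices: [z k.+1] is at most [c k], which is below l + 1/(k+1). *)
rewrite -(cvg_shiftn 1).
apply: (@squeeze_cvgr _ _ _ _ (fun=> l) (fun k => l + k.+1%:R^-1)).
- near=> k; rewrite lbS //= addn1 /= ge_min; apply/orP; right.
  exact/ltW/(Hc k).2.
- exact: cvg_cst.
- rewrite -[X in _ --> X]addr0; apply: cvgD; first exact: cvg_cst.
  exact: cvg_harmonic.
Unshelve. all: by end_near. Qed.

Section DynamicProgramming.
Set Implicit Arguments.
Unset Strict Implicit.
Variables (R : realType) (n m T : nat).
Variables (U : set 'rV[R]_m) (X : nat -> set 'rV[R]_n).
Variable f : 'rV[R]_n -> 'rV[R]_m -> nat -> 'rV[R]_n.
Variables (phi : nat -> 'rV[R]_n -> 'rV[R]_m -> R -> R) (phiT : 'rV[R]_n -> R).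

Local Notation Gamma := (Gamma f X U).
Local Notation phi_image := (phi_image T X U phi phiT).

(** Costs of feasible continuations, as a relation built backward in time. Unlike [phi_image], it
    ties successive states together by the dynamics [f]. *)
Inductive cost_to_go : nat -> 'rV[R]_n -> R -> Prop :=
| cost_to_go_last x : X T x -> cost_to_go T x (phiT x)
| cost_to_go_step t x u c : (t < T)%N -> X t x -> Gamma x t u ->
    cost_to_go t.+1 (f x u t) c -> cost_to_go t x (phi t x u c).

Lemma cost_to_go_image t x c : cost_to_go t x c -> phi_image t c.
Proof.
elim=> [y Xy|k y u d kT Xy [Uu _] _ IH]; first exact: phi_image_last.
exact: phi_image_step.
Qed.

Lemma cost_to_goT x c : cost_to_go T x c -> c = phiT x.
Proof.
move: {1 3}T (erefl T) => t tT h; case: h tT => // k y u d kT _ _ _ kE.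
by rewrite kE ltnn in kT.
Qed.

Lemma cost_to_go_inv t x c : (t < T)%N -> cost_to_go t x c ->
  exists u d, [/\ Gamma x t u, cost_to_go t.+1 (f x u t) d & c = phi t x u d].
Proof.
move=> tT h; case: h tT => [y _|k y u d kT Xy Gu hd _]; first by rewrite ltnn.
by exists u, d.
Qed.

Section Value.
Hypothesis phi_mono : forall t z w, (t < T)%N ->
  phi_image t.+1 z -> phi_image t.+1 w -> w <= z ->
  forall x u, X t x -> U u -> phi t x u w <= phi t x u z.
Hypothesis phi_usc : forall t x u (z : nat -> R) (l : R),
  (t < T)%N -> X t x -> U u ->
  (forall k, phi_image t.+1 (z k)) -> (forall k, z k.+1 <= z k) ->
  z @ \oo --> l -> (fun k => phi t x u (z k)) @ \oo --> phi t x u l.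
Variable V : 'rV[R]_n -> nat -> R.
Hypothesis bellman : generalized_Bellman T f X U phi phiT V.

(** Bellman's equation makes the extended infimum the finite number [V x t], so attaining it is an
    equation between reals. *)
Lemma arginfP t x u : (t < T)%N -> X t x ->
  arginf (Gamma x t) (fun v => phi t x v (V (f x v t) t.+1)) u <->
  Gamma x t u /\ phi t x u (V (f x u t) t.+1) = V x t.
Proof.
move=> tT Xx; rewrite /arginf /= -(bellman.2 t x tT Xx).
by split=> -[Gu e]; split => //; [case: e | rewrite e].
Qed.

(** Backward induction on [t]. Since [V] may lie outside the image, [phi t] at [V] is reached only
    through costs-to-go decreasing to it. *)
Lemma value_inf t : (t <= T)%N -> forall x, X t x ->
  (forall c, cost_to_go t x c -> V x t <= c) /\
  (forall y, V x t < y -> exists2 c, cost_to_go t x c & c < y).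
Proof.
move: t; apply: descending_ind => [x Xx|t tT IH x Xx].
  rewrite (bellman.1 x Xx); split=> [c /cost_to_goT -> //|y ltxy].
  by exists (phiT x) => //; exact: cost_to_go_last.
have Vinf := bellman.2 t x tT Xx.
split=> [c /(cost_to_go_inv tT)[u [d [Gu hd ->]]]|y Vy].
- have [Uu Xu] := Gu; have [lb approx] := IH _ Xu.
  (* Starting the sequence at [d] gives [z k <= d] with both in the image; monotonicity bounds the
     cost at [z k] by that at [d], and the bound passes to the limit. *)
  have [z [z0 Sz zdec zcvg]] := decreasing_cvg_inf _ _ _ _ hd lb approx.
  have zim k := cost_to_go_image (Sz k).
  apply: (@le_trans _ _ (phi t x u (V (f x u t) t.+1))).
    by rewrite -lee_fin Vinf; apply: ereal_inf_lbound; exists u.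
  have zcvg' := phi_usc tT Xx Uu zim zdec zcvg.
  apply: (cvgr_to_le zcvg').
  near=> k; apply: phi_mono => //; first exact: cost_to_go_image hd.
  by rewrite -z0; move/nonincreasing_seqP: zdec; exact.
- have : (ereal_inf [set (phi t x u (V (f x u t) t.+1))%:E | u in Gamma x t]
          < y%:E)%E by rewrite -Vinf lte_fin.
  move=> /ereal_inf_lt[_ [u Gu <-]]; rewrite lte_fin => phiy.
  have [Uu Xu] := Gu; have [lb approx] := IH _ Xu.
  (* The threshold is arbitrary: any cost-to-go can start the sequence. *)
  have [|d hd _] := approx (V (f x u t) t.+1 + 1); first by rewrite ltrDl.
  have [z [z0 Sz zdec zcvg]] := decreasing_cvg_inf _ _ _ _ hd lb approx.
  have zim k := cost_to_go_image (Sz k).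
  have zcvg' := phi_usc tT Xx Uu zim zdec zcvg.
  (* The costs at [z k] converge to a limit below [y], so one of them is already below [y]. *)
  have [k _ /(_ k (leqnn k))/= phik] := cvgr_lt _ zcvg' _ phiy.
  by exists (phi t x u (z k)) => //; exact: cost_to_go_step.
Unshelve. all: by end_near. Qed.

End Value.

Definition tail_cost (u : 'I_T -> 'rV[R]_m) (x : 'I_T.+1 -> 'rV[R]_n) k : R :=
  foldr (fun (t : 'I_T) z => phi t (x (inord t)) (u t) z)
        (phiT (x ord_max)) (drop k (enum 'I_T)).

Lemma tail_cost0 u x : tail_cost u x 0 = nested_phi phi phiT u x.
Proof. by rewrite /tail_cost drop0. Qed.

Lemma tail_costT u x : tail_cost u x T = phiT (x (inord T)).
Proof.
rewrite /tail_cost drop_oversize ?size_enum_ord //=.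
by congr (phiT (x _)); apply/val_inj; rewrite /= inordK.
Qed.

Lemma tail_costS u x (k : 'I_T) :
  tail_cost u x k = phi k (x (inord k)) (u k) (tail_cost u x k.+1).
Proof.
by rewrite /tail_cost (drop_nth k) ?size_enum_ord //= nth_ord_enum.
Qed.

(** Lets earlier stages be overwritten once the later ones have been chosen. *)
Lemma eq_tail_cost u x v y k : (k <= T)%N ->
  (forall s : 'I_T, (k <= s)%N -> u s = v s) ->
  (forall s : 'I_T.+1, (k <= s)%N -> x s = y s) ->
  tail_cost u x k = tail_cost v y k.
Proof.
move: k; apply: descending_ind => [_ exy|k kT IH euv exy].
  by rewrite !tail_costT exy // inordK.
rewrite -[k]/(val (Ordinal kT)) !tail_costS /= euv // exy ?inordK // 1?ltnW //.
by rewrite IH // => s /ltnW; [exact: euv | exact: exy].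
Qed.

Lemma feasible_tail_cost x0 u x k : (k <= T)%N -> feasible f X U x0 u x ->
  cost_to_go k (x (inord k)) (tail_cost u x k).
Proof.
move=> + [_ dyn Uu Xx]; move: k; apply: descending_ind => [|k kT IH].
  by rewrite tail_costT; apply: cost_to_go_last; have := Xx (inord T); rewrite inordK.
have [Xk Xk1] : X k (x (inord k)) /\ X k.+1 (x (inord k.+1)).
  by have := Xx (inord k); have := Xx (inord k.+1); rewrite !inordK // 1?ltnW.
have /= dynk := dyn (Ordinal kT).
rewrite -{3}[k]/(val (Ordinal kT)) tail_costS.
apply: cost_to_go_step => //=; last by rewrite -dynk.
by split; rewrite -?dynk.
Qed.

(** Converse to [feasible_tail_cost]: the trajectory is assembled backward, and its entries before
    [k] stay arbitrary. *)
Lemma cost_to_go_tail k y c : cost_to_go k y c ->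
  exists u x, [/\ x (inord k) = y,
    forall t : 'I_T, (k <= t)%N ->
      x (inord t.+1) = f (x (inord t)) (u t) t /\ U (u t),
    forall t : 'I_T.+1, (k <= t)%N -> X t (x t)
    & tail_cost u x k = c].
Proof.
elim=> {k y c} [y Xy|k y v c kT Xy [Uv Xv] _ [u [x [xk dyn Xx cE]]]].
  (* No stage t < T satisfies T <= t, so the input 0 need not lie in [U]. *)
  exists (fun=> 0), (fun=> y); split => // [t|t Tt|]; last exact: tail_costT.
    by rewrite leqNgt ltn_ord.
  by have -> : t = T :> nat by apply/eqP; rewrite eqn_leq Tt -ltnS ltn_ord.
(* Stage [k] is written in front of the trajectory obtained from k+1 on. *)
pose u' (s : 'I_T) := if s == k :> nat then v else u s.
pose x' (s : 'I_T.+1) := if s == k :> nat then y else x s.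
have x'k : x' (inord k) = y by rewrite /x' inordK ?eqxx // ltnW.
have x'gt (s : nat) : (k < s <= T)%N -> x' (inord s) = x (inord s).
  by case/andP=> ks sT; rewrite /x' inordK // gtn_eqF.
exists u', x'; split => // [t|t|].
- rewrite leq_eqVlt => /orP[/eqP kt|kt].
    by rewrite -kt x'k x'gt ?ltnSn // xk /u' -kt eqxx.
  rewrite !x'gt ?kt ?(ltnW (ltn_ord t)) ?ltn_ord ?andbT ?ltnS ?(ltnW kt) //.
  by rewrite /u' gtn_eqF //; exact: dyn.
- by rewrite leq_eqVlt eq_sym /x'; case: eqP => [->|_ /=] //; exact: Xx.
- rewrite -[k]/(val (Ordinal kT)) tail_costS /= x'k {1}/u' eqxx -cE.
  by congr (phi _ _ _ _); apply: eq_tail_cost => // s ks; rewrite /u' /x' gtn_eqF.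
Qed.

Lemma cost_to_go_feasible x0 c : cost_to_go 0 x0 c ->
  exists (u : 'I_T -> 'rV[R]_m) (x : 'I_T.+1 -> 'rV[R]_n),
    feasible f X U x0 u x /\ nested_phi phi phiT u x = c.
Proof.
move=> /cost_to_go_tail[u [x [x0E dyn Xx cE]]]; exists u, x.
rewrite -tail_cost0; split => //; split => [|t|t|t].
- by rewrite -x0E; congr x; apply/val_inj; rewrite /= inordK.
- by have [] := dyn t isT.
- by have [] := dyn t isT.
- exact: Xx.
Qed.

(** Prefixing the cheaper continuation with the trajectory's own inputs, one stage at a time down to
    0, keeps the gap strict: both costs are costs-to-go, hence in the image where strict
    monotonicity applies. *)
Lemma cheaper_tail_cheaper x0 u x k c :
  strictly_monotonic T X U phi phiT -> feasible f X U x0 u x -> (k <= T)%N ->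
  cost_to_go k (x (inord k)) c -> c < tail_cost u x k ->
  exists2 d, cost_to_go 0 (x (inord 0)) d & d < tail_cost u x 0.
Proof.
move=> strict feas; have [_ dyn Uu Xx] := feas.
elim: k c => [|k IH] c kT hc ltc; first by exists c.
have htail := feasible_tail_cost kT feas.
have Xk : X k (x (inord k)).
  by have := Xx (inord k); rewrite inordK // ltnW.
have Xk1 : X k.+1 (x (inord k.+1)).
  by have := Xx (inord k.+1); rewrite inordK.
have /= dynk := dyn (Ordinal kT).
apply: (IH (phi k (x (inord k)) (u (Ordinal kT)) c)); first exact: ltnW.
  by apply: cost_to_go_step => //; [split|]; rewrite -?dynk.
rewrite -{4}[k]/(val (Ordinal kT)) tail_costS.
by apply: strict => //; [exact: cost_to_go_image htail | exact: cost_to_go_image hc].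
Qed.

End DynamicProgramming.

Theorem theorem10 (R : realType) (n m T : nat)
  (U : set 'rV[R]_m) (X : nat -> set 'rV[R]_n)
  (f : 'rV[R]_n -> 'rV[R]_m -> nat -> 'rV[R]_n)
  (x0 : 'rV[R]_n) (hx0 : X 0%N x0)
  (J : ('I_T -> 'rV[R]_m) -> ('I_T.+1 -> 'rV[R]_n) -> R)
  (phi : nat -> 'rV[R]_n -> 'rV[R]_m -> R -> R) (phiT : 'rV[R]_n -> R)
  (hJ : naturally_monotonically_backward_separable X U phi phiT J)
  (hGamma : forall t x, (t < T)%N -> X t x -> Gamma f X U x t !=set0)
  (hstrict : strictly_monotonic T X U phi phiT)
  (V : 'rV[R]_n -> nat -> R)
  (hV : generalized_Bellman T f X U phi phiT V)
  (us : 'I_T -> 'rV[R]_m) (xs : 'I_T.+1 -> 'rV[R]_n) :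
  solves_MSOP f X U J x0 us xs <->
  [/\ xs ord0 = x0,
      forall k : 'I_T, xs (inord k.+1) = f (xs (inord k)) (us k) k
    & forall k : 'I_T,
        arginf (Gamma f X U (xs (inord k)) k)
          (fun u => phi k (xs (inord k)) u
                      (V (f (xs (inord k)) u k) k.+1)) (us k)].
Proof.
have [[JE mono] usc _] := hJ.
have Vinf := @value_inf _ _ _ _ _ _ _ _ _ mono usc _ hV.
have i0 : inord 0 = ord0 :> 'I_T.+1 by apply/val_inj; rewrite /= inordK.
have JcE u x : feasible f X U x0 u x -> J u x = tail_cost phi phiT u x 0.
  by case=> _ _ Uu Xx; rewrite tail_cost0 JE.
split=> [[feas opt]|[xs0 dyn arg]].
- have [xs0 dyn Uu Xx] := feas; split => // k.
  have Xxs t : (t <= T)%N -> X t (xs (inord t)).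
    by move=> tT; have := Xx (inord t); rewrite inordK.
  (* A cheaper continuation at any stage would yield a feasible pair beating the optimal one. *)
  have tailV t : (t <= T)%N -> tail_cost phi phiT us xs t = V (xs (inord t)) t.
    move=> tT; have [lb approx] := Vinf _ tT _ (Xxs _ tT).
    apply/eqP; rewrite eq_le lb ?andbT; last exact: feasible_tail_cost feas.
    rewrite leNgt; apply/negP => /approx[c hc ltc].
    have [d] := cheaper_tail_cheaper hstrict feas tT hc ltc.
    rewrite i0 xs0 => /cost_to_go_feasible[u [x [fx <-]]].
    by rewrite -tail_cost0 -!JcE // ltNge opt.
  (* With [tailV] at [k] and k+1, the recursion [tail_costS] is exactly the equation characterising
     [arginf]. *)
  apply/(arginfP hV _ (ltn_ord k)); first exact/Xxs/ltnW.
  rewrite -(dyn k); split; last by rewrite -!tailV ?(ltnW (ltn_ord k)) // tail_costS.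
  by split => //; rewrite -dyn; exact: Xxs.
(* The state constraints come from [Gamma]: each chosen input sends the state into the next
   constraint set. *)
- have Xxs t : (t <= T)%N -> X t (xs (inord t)).
    elim: t => [|t IH] tT; first by rewrite i0 xs0.
    have [[_ Xf] _] := arg (Ordinal tT).
    by rewrite (dyn (Ordinal tT)).
  have argV k := (arginfP hV _ (ltn_ord k) (Xxs _ (ltnW (ltn_ord k)))).1 (arg k).
  have feas : feasible f X U x0 us xs.
    split => // [t|t]; first by have [[]] := argV t.
    by have := Xxs t; rewrite inord_val -ltnS ltn_ord; exact.
  split=> // u x fx; rewrite !JcE //.
  (* Backward from [T], the equations [argV] identify the tail cost with [V] at every stage. *)
  have -> : tail_cost phi phiT us xs 0 = V x0 0%N.
    rewrite -xs0 -i0; move: (leq0n T); move: 0%N.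
    apply: descending_ind => [|t tT IH].
      by rewrite tail_costT (hV.1 _ (Xxs _ (leqnn T))).
    have [_] := argV (Ordinal tT).
    by rewrite -dyn -IH -tail_costS.
  (* The cost of any feasible pair is a cost-to-go from [x0], which [V] bounds below. *)
  apply: (Vinf _ (leq0n T) _ hx0).1.
  by have := feasible_tail_cost phi phiT (leq0n T) fx; rewrite i0; case: fx => ->.
Qed.
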